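(* The finite-dimensional right representations $\pi_{\alpha,\gamma}$ of $\mathbb{C}S$ are irreducible, and the family of all $\pi_{\alpha,\gamma}$ separates the points of $\mathbb{C}S$, i.e. for each non-zero $a\in\mathbb{C}S$ some $\pi_{\alpha,\gamma}$ does not annihilate $a$.
   Context: $S$ is the semigroup with identity generated by $x$ and $y$, subject to $y$ being invertible and $yx=xy^2$; thus $S=\{x^my^n:m\in\mathbb{Z},\ m\ge0,\ n\in\mathbb{Z}\}$ with product $x^my^n\,x^py^q=x^{m+p}y^{n2^p+q}$. $\mathbb{C}S$ is its complex semigroup algebra. Let $\alpha\in\mathbb{C}\setminus\{0\}$ satisfy $\alpha^{2^k}=\alpha$ for some positive integer $k$, with $k$ taken minimal, and let $\gamma\in\mathbb{C}$, $\gamma\ne0$. Let $X$ be the $k\times k$ matrix with $X_{1,k}=1$, $X_{i,i-1}=1$ for $2\le i\le k$ and all other entries $0$ (so $X=[1]$ if $k=1$), and let $Y=\mathrm{diag}(\alpha,\alpha^2,\alpha^4,\dots,\alpha^{2^{k-1}})$. Then $\pi_{\alpha,\gamma}$ is the right representation of $\mathbb{C}S$ on $\mathbb{C}^k$ (matrices acting on row vectors from the right) determined by $x\mapsto\gamma X$, $y\mapsto Y$. A right representation is irreducible if it is non-zero and has no invariant subspaces other than $(0)$ and the whole space. *)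

(* Defs.v *)
From HB Require Import structures.
From mathcomp Require Import all_boot all_order all_algebra finmap.
From mathcomp Require Import reals complex.
From mathcomp Require Import monalg.

Set Implicit Arguments.
Unset Strict Implicit.
Unset Printing Implicit Defensive.

Import GRing.Theory.
Local Open Scope ring_scope.

(* The library's product on {malg R[G]} is only available when G has no        *)
(* non-trivial units, which excludes [xy_semigroup] below; hence this copy of *)
(* the module {malg R[G]} with the convolution product of an arbitrary monoid. *)
Definition monoid_algebra (R : nzRingType) (G : monoidType) : Type :=
  {malg R[G]}.

HB.instance Definition _ (R : nzRingType) (G : monoidType) :=
  GRing.Lmodule.copy (monoid_algebra R G) {malg R[G]}.

HB.lock Definition monoid_algebra_mul (R : nzRingType) (G : monoidType)
    (a b : monoid_algebra R G) : monoid_algebra R G :=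
  \sum_(s <- msupp a) \sum_(t <- msupp b) << a@_s * b@_t *g (s * t)%g >>.

Section MonoidAlgebra.

Variables (R : nzRingType) (G : monoidType).
Local Notation RG := (monoid_algebra R G).
Implicit Types (a b c : RG) (s t : G) (u v : R).

Definition monoid_algebra_one : RG := << 1 *g 1%g >>.

Local Notation one := monoid_algebra_one.
Local Notation mul := (@monoid_algebra_mul R G).

Lemma monoid_algebra_mulEw (d1 d2 : {fset G}) a b :
    (msupp a `<=` d1)%fset -> (msupp b `<=` d2)%fset ->
  mul a b = \sum_(s <- d1) \sum_(t <- d2) << a@_s * b@_t *g (s * t)%g >>.
Proof.
move=> le1 le2; rewrite [monoid_algebra_mul]unlock (big_fset_incl _ le1) /=.
  apply/eq_bigr=> s _; apply/big_fset_incl => // t _ /mcoeff_outdom ->.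
  by rewrite mulr0 monalgU0.
move=> s _ /mcoeff_outdom as0.
by rewrite big1 => // t _; rewrite as0 mul0r monalgU0.
Qed.

Lemma monoid_algebra_mulDl : left_distributive mul +%R.
Proof.
move=> a b c.
rewrite (monoid_algebra_mulEw (msuppD_le a b) (fsubset_refl _)).
rewrite (monoid_algebra_mulEw (fsubsetUl (msupp a) (msupp b)) (fsubset_refl _)).
rewrite (monoid_algebra_mulEw (fsubsetUr (msupp a) (msupp b)) (fsubset_refl _)).
rewrite -big_split /=; apply/eq_bigr=> s _.
rewrite -big_split /=; apply/eq_bigr=> t _.
by rewrite (mcoeffD s a b) mulrDl monalgUD.
Qed.

Lemma monoid_algebra_mulDr : right_distributive mul +%R.
Proof.
move=> a b c.
rewrite (monoid_algebra_mulEw (fsubset_refl _) (msuppD_le b c)).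
rewrite (monoid_algebra_mulEw (fsubset_refl _) (fsubsetUl (msupp b) (msupp c))).
rewrite (monoid_algebra_mulEw (fsubset_refl _) (fsubsetUr (msupp b) (msupp c))).
rewrite -big_split /=; apply/eq_bigr=> s _.
rewrite -big_split /=; apply/eq_bigr=> t _.
by rewrite (mcoeffD t b c) mulrDr monalgUD.
Qed.

Lemma monoid_algebra_mul0r b : mul 0 b = 0.
Proof. by rewrite [monoid_algebra_mul]unlock msupp0 big_seq_fset0. Qed.

Lemma monoid_algebra_mulr0 a : mul a 0 = 0.
Proof.
by rewrite [monoid_algebra_mul]unlock big1 // => s _;
  rewrite msupp0 big_seq_fset0.
Qed.

Lemma monoid_algebra_mulUU u v s t :
  mul << u *g s >> << v *g t >> = << u * v *g (s * t)%g >>.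
Proof.
by rewrite (monoid_algebra_mulEw msuppU_le msuppU_le) !big_seq_fset1 !mcoeffUU.
Qed.

Lemma monoid_algebra_ind (P : RG -> Prop) :
    P 0 -> (forall a b, P a -> P b -> P (a + b)) ->
    (forall u s, P << u *g s >>) -> forall a, P a.
Proof.
by move=> P0 PD PU a; rewrite (monalgE a); apply: (big_ind P).
Qed.

Lemma monoid_algebra_mulA : associative mul.
Proof.
move=> a b c; elim/monoid_algebra_ind: a => [|a1 a2 IH1 IH2|u s].
- by rewrite !monoid_algebra_mul0r.
- by rewrite !monoid_algebra_mulDl IH1 IH2.
elim/monoid_algebra_ind: b => [|b1 b2 IH1 IH2|v t].
- by rewrite !(monoid_algebra_mul0r, monoid_algebra_mulr0).
- by rewrite !(monoid_algebra_mulDl, monoid_algebra_mulDr) IH1 IH2.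
elim/monoid_algebra_ind: c => [|c1 c2 IH1 IH2|w r].
- by rewrite !monoid_algebra_mulr0.
- by rewrite !monoid_algebra_mulDr IH1 IH2.
by rewrite !monoid_algebra_mulUU mulrA mulgA.
Qed.

Lemma monoid_algebra_mul1r : left_id one mul.
Proof.
elim/monoid_algebra_ind => [|a b IHa IHb|u s].
- exact: monoid_algebra_mulr0.
- by rewrite monoid_algebra_mulDr IHa IHb.
by rewrite monoid_algebra_mulUU mul1r mul1g.
Qed.

Lemma monoid_algebra_mulr1 : right_id one mul.
Proof.
elim/monoid_algebra_ind => [|a b IHa IHb|u s].
- exact: monoid_algebra_mul0r.
- by rewrite monoid_algebra_mulDl IHa IHb.
by rewrite monoid_algebra_mulUU mulr1 mulg1.
Qed.

Lemma monoid_algebra_oner_neq0 : one != 0.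
Proof.
apply/eqP => /(congr1 (mcoeff 1%g)) /eqP.
by rewrite mcoeffUU mcoeff0 oner_eq0.
Qed.

HB.instance Definition _ := GRing.Zmodule_isNzRing.Build RG
  monoid_algebra_mulA monoid_algebra_mul1r monoid_algebra_mulr1
  monoid_algebra_mulDl monoid_algebra_mulDr monoid_algebra_oner_neq0.

Lemma monoid_algebraMUU u v s t :
  (<< u *g s >> : RG) * (<< v *g t >> : RG) = << u * v *g (s * t)%g >>.
Proof. exact: monoid_algebra_mulUU. Qed.

Lemma monoid_algebraZU u v s :
  (u *: (<< v *g s >> : RG)) = << u * v *g s >>.
Proof. by apply/malgP => t; rewrite mcoeffZ !mcoeffU mulrnAr. Qed.

Lemma monoid_algebra_scaleAl u a b : u *: (a * b) = (u *: a) * b.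
Proof.
elim/monoid_algebra_ind: a => [|a1 a2 IH1 IH2|v s].
- by rewrite mul0r !scaler0 mul0r.
- by rewrite mulrDl !scalerDr mulrDl IH1 IH2.
elim/monoid_algebra_ind: b => [|b1 b2 IH1 IH2|w t].
- by rewrite !mulr0 scaler0.
- by rewrite !mulrDr scalerDr IH1 IH2.
by rewrite monoid_algebraZU !monoid_algebraMUU monoid_algebraZU mulrA.
Qed.

HB.instance Definition _ :=
  GRing.Lmodule_isLalgebra.Build R RG monoid_algebra_scaleAl.

End MonoidAlgebra.

Section MonoidAlgebraCom.

Variables (R : comNzRingType) (G : monoidType).
Local Notation RG := (monoid_algebra R G).

Lemma monoid_algebra_scaleAr (u : R) (a b : RG) : u *: (a * b) = a * (u *: b).
Proof.
elim/monoid_algebra_ind: a => [|a1 a2 IH1 IH2|v s].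
- by rewrite !mul0r scaler0.
- by rewrite !mulrDl scalerDr IH1 IH2.
elim/monoid_algebra_ind: b => [|b1 b2 IH1 IH2|w t].
- by rewrite mulr0 !scaler0 mulr0.
- by rewrite mulrDr !scalerDr mulrDr IH1 IH2.
by rewrite monoid_algebraZU !monoid_algebraMUU monoid_algebraZU mulrCA.
Qed.

HB.instance Definition _ :=
  GRing.Lalgebra_isAlgebra.Build R RG monoid_algebra_scaleAr.

End MonoidAlgebraCom.

(* The semigroup S: [XY m n] is x^m y^n. Lemma xy_semigroup_universal shows    *)
(* that this is the monoid generated by x and an invertible y subject to       *)
(* yx = xy^2.                                                                  *)
Record xy_semigroup := XY { xdeg : nat; ydeg : int }.

Definition xy_pair s := (xdeg s, ydeg s).
Lemma xy_pairK : cancel xy_pair (fun p => XY p.1 p.2).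
Proof. by case. Qed.

HB.instance Definition _ := Choice.copy xy_semigroup (can_type xy_pairK).

Definition xy_one := XY 0 0.
Definition xy_mul s t :=
  XY (xdeg s + xdeg t) (ydeg s * 2 ^+ xdeg t + ydeg t).

Lemma xy_mulA : associative xy_mul.
Proof.
case=> m n [p q] [r t]; congr XY; rewrite /= ?addnA //.
by rewrite exprD mulrDl mulrA addrA.
Qed.

Lemma xy_mul1s : left_id xy_one xy_mul.
Proof. by case=> m n; congr XY; rewrite /= mul0r add0r. Qed.

Lemma xy_muls1 : right_id xy_one xy_mul.
Proof. by case=> m n; congr XY; rewrite /= ?addn0 // expr0 mulr1 addr0. Qed.

HB.instance Definition _ := isSemigroup.Build xy_semigroup xy_mulA.
HB.instance Definition _ :=
  Semigroup_isMonoid.Build xy_semigroup xy_mul1s xy_muls1.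

Definition xy_x : xy_semigroup := XY 1 0.
Definition xy_y : xy_semigroup := XY 0 1.
Definition xy_yV : xy_semigroup := XY 0 (-1).

Section Presentation.

Local Open Scope group_scope.

Lemma xy_yyV : xy_y * xy_yV = 1. Proof. by []. Qed.
Lemma xy_yVy : xy_yV * xy_y = 1. Proof. by []. Qed.
Lemma xy_yx : xy_y * xy_x = xy_x * xy_y ^+ 2. Proof. by []. Qed.

Lemma xy_xexp m : xy_x ^+ m = XY m 0.
Proof.
by elim: m => // m IH; rewrite expgS IH; congr XY; rewrite /= mul0r add0r.
Qed.

Lemma xy_yexp n : xy_y ^+ n = XY 0 n.
Proof.
by elim: n => // n IH; rewrite expgS IH; congr XY.
Qed.

Lemma xy_yVexp n : xy_yV ^+ n = XY 0 (- n%:Z)%R.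
Proof.
elim: n => // n IH; rewrite expgS IH; congr XY.
by rewrite /= expr0 mulr1 -[in RHS]add1n PoszD opprD.
Qed.

(* The integer power v^n, for w an inverse of v in a monoid.                   *)
Definition zexpg (M : monoidType) (v w : M) (n : int) : M :=
  match n with Posz k => v ^+ k | Negz k => w ^+ k.+1 end.

Lemma XYE m n : XY m n = xy_x ^+ m * zexpg xy_y xy_yV n.
Proof.
rewrite xy_xexp; case: n => n; rewrite /zexpg ?xy_yexp ?xy_yVexp.
  by congr XY; rewrite /= ?addn0 // mul0r add0r.
by congr XY; rewrite /= ?addn0 // mul0r add0r NegzE.
Qed.

Variables (M : monoidType) (u v w : M).
Hypotheses (vw : v * w = 1) (wv : w * v = 1) (vu : v * u = u * v ^+ 2).
Local Notation vz := (zexpg v w).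

Lemma zexpgS n : vz (1 + n)%R = v * vz n.
Proof.
case: n => [n|[|n]].
- by rewrite -PoszD add1n /zexpg expgS.
- have -> : (1 + Negz 0 = 0%:Z)%R by [].
  by rewrite /zexpg expg1 vw.
- have -> : (1 + Negz n.+1 = Negz n)%R.
    by rewrite !NegzE -[in LHS]add1n PoszD opprD addrA subrr add0r.
  by rewrite /zexpg [in RHS]expgS mulgA vw mul1g.
Qed.

Lemma zexpgP n : vz (-1 + n)%R = w * vz n.
Proof.
by rewrite -[in RHS](addKr (-1)%R n) opprK zexpgS mulgA wv mul1g.
Qed.

Lemma zexpg_ind (P : int -> Prop) :
    P 0%R -> (forall n, P n -> P (1 + n)%R) -> (forall n, P n -> P (-1 + n)%R) ->
  forall n, P n.
Proof.
move=> P0 PS PP; elim/int_rect=> // n IH.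
  by rewrite -add1n PoszD; apply: PS.
by rewrite -add1n PoszD opprD; apply: PP.
Qed.

Lemma zexpgD m n : vz (m + n)%R = vz m * vz n.
Proof.
elim/zexpg_ind: m => [|m IH|m IH]; first by rewrite add0r mul1g.
  by rewrite -addrA !zexpgS IH mulgA.
by rewrite -addrA !zexpgP IH mulgA.
Qed.

Lemma zexpg_comm1 n : vz n * u = u * vz (n * 2)%R.
Proof.
elim/zexpg_ind: n => [|n IH|n IH]; first by rewrite mul0r mul1g mulg1.
  have -> : ((1 + n) * 2 = 2%:Z + n * 2)%R by rewrite mulrDl mul1r.
  by rewrite zexpgS zexpgD -mulgA IH !mulgA vu expg2 !mulgA.
have wu : w * u = u * w ^+ 2.
  have v2w2 : v ^+ 2 * w ^+ 2 = 1.
    by rewrite !expg2 -mulgA [v * (w * w)]mulgA vw mul1g vw.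
  have wuv : w * (u * v ^+ 2) = u by rewrite -vu mulgA wv mul1g.
  by rewrite -[LHS]mulg1 -v2w2 (mulgA (w * u)) -(mulgA w u) wuv.
have -> : ((-1 + n) * 2 = - 2%:Z + n * 2)%R by rewrite mulrDl mulN1r.
by rewrite zexpgP zexpgD -mulgA IH !mulgA wu expg2 !mulgA.
Qed.

Lemma zexpg_comm n p : vz n * u ^+ p = u ^+ p * vz (n * 2 ^+ p)%R.
Proof.
elim: p n => [|p IH] n; first by rewrite expr0 mulr1 mulg1 mul1g.
by rewrite expgS mulgA zexpg_comm1 -mulgA IH mulgA exprS mulrA.
Qed.

Lemma xy_semigroup_universal :
  exists f : xy_semigroup -> M,
    [/\ f 1 = 1, {morph f : s t / s * t}, f xy_x = u, f xy_y = v
      & forall g : xy_semigroup -> M, g 1 = 1 -> {morph g : s t / s * t} ->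
          g xy_x = u -> g xy_y = v -> g =1 f].
Proof.
have expgM m n : u ^+ (m + n) = u ^+ m * u ^+ n.
  by elim: m => [|m IH]; rewrite ?mul1g // addSn !expgS IH mulgA.
exists (fun s => u ^+ xdeg s * vz (ydeg s)); split=> //=.
- by rewrite expg0 mul1g.
- case=> m n [p q] /=; rewrite expgM zexpgD -!mulgA; congr (_ * _).
  by rewrite !mulgA zexpg_comm.
- by rewrite expg1 mulg1.
- by rewrite expg0 mul1g expg1.
move=> g g1 gM gx gy [m n] /=; rewrite XYE gM.
have gX s k : g (s ^+ k) = g s ^+ k.
  by elim: k => [|k IH] //; rewrite !expgS gM IH.
have gyV : g xy_yV = w.
  by rewrite -[LHS]mulg1 -vw mulgA -gy -gM xy_yVy g1 mul1g.
by rewrite gX gx; case: n => n; rewrite /zexpg gX ?gy ?gyV.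
Qed.

End Presentation.

Section Representation.

Variables (F : fieldType) (A : unitAlgType F) (u v : A).

Definition xy_eval (s : xy_semigroup) : A := u ^+ xdeg s * v ^ ydeg s.

(* The linear extension of x^m y^n |-> u^m v^n.                                *)
Definition xy_linear_ext (a : monoid_algebra F xy_semigroup) : A :=
  \sum_(s <- msupp a) a@_s *: xy_eval s.

Lemma xy_linear_extEw (d : {fset xy_semigroup})
    (a : monoid_algebra F xy_semigroup) : (msupp a `<=` d)%fset ->
  xy_linear_ext a = \sum_(s <- d) a@_s *: xy_eval s.
Proof.
move=> le; rewrite /xy_linear_ext (big_fset_incl _ le) //= => s _.
by move=> /mcoeff_outdom ->; rewrite scale0r.
Qed.

Lemma xy_linear_ext_is_linear : linear xy_linear_ext.
Proof.
move=> c a b.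
set d := (msupp a `|` msupp b)%fset.
have lea : (msupp a `<=` d)%fset by apply: fsubsetUl.
have leb : (msupp b `<=` d)%fset by apply: fsubsetUr.
have leab : (msupp (c *: a + b) `<=` d)%fset.
  apply: fsubset_trans (msuppD_le _ _) _; apply: fsetSU; exact: msuppZ_le.
rewrite (xy_linear_extEw lea) (xy_linear_extEw leb) (xy_linear_extEw leab).
rewrite scaler_sumr -big_split /=; apply: eq_bigr => s _.
by rewrite (mcoeffD s (c *: a) b) (mcoeffZ c a) scalerDl scalerA.
Qed.

HB.instance Definition _ := GRing.isLinear.Build F
  (monoid_algebra F xy_semigroup) A *:%R xy_linear_ext xy_linear_ext_is_linear.

Lemma xy_linear_ext0 : xy_linear_ext 0 = 0.
Proof. exact: raddf0. Qed.

Lemma xy_linear_extD : {morph xy_linear_ext : a b / a + b}.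
Proof. exact: raddfD. Qed.

Lemma xy_linear_extU c s : xy_linear_ext << c *g s >> = c *: xy_eval s.
Proof. by rewrite (xy_linear_extEw msuppU_le) big_seq_fset1 mcoeffUU. Qed.

Hypotheses (v_unit : v \is a GRing.unit) (vu : v * u = u * v ^+ 2).

Lemma xy_exprz_comm1 n : v ^ n * u = u * v ^ (n * 2).
Proof.
elim/zexpg_ind: n => [|n IH|n IH]; first by rewrite mul0r mul1r mulr1.
  have -> : (1 + n) * 2 = 2%:Z + n * 2 by rewrite mulrDl mul1r.
  by rewrite !(exprzDr v_unit) -mulrA IH !mulrA vu expr2 !mulrA.
have wu : v^-1 * u = u * v ^- 2.
  apply: (mulrI v_unit); rewrite mulrA divrr // mul1r mulrA vu -mulrA.
  by rewrite divrr ?mulr1 // unitrX.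
have -> : (-1 + n) * 2 = - 2%:Z + n * 2 by rewrite mulrDl mulN1r.
by rewrite !(exprzDr v_unit) -mulrA IH mulrA wu mulrA.
Qed.

Lemma xy_exprz_comm n p : v ^ n * u ^+ p = u ^+ p * v ^ (n * 2 ^+ p).
Proof.
elim: p n => [|p IH] n; first by rewrite !expr0 mulr1 mulr1 mul1r.
rewrite (exprS u) (mulrA _ u) xy_exprz_comm1 -(mulrA u) IH (mulrA u).
by rewrite exprS (mulrA n).
Qed.

Lemma xy_evalM s t : xy_eval (s * t)%g = xy_eval s * xy_eval t.
Proof.
case: s t => [m n] [p q]; rewrite /xy_eval /= exprD (exprzDr v_unit).
by rewrite -!mulrA; congr (_ * _); rewrite !mulrA xy_exprz_comm.
Qed.

Lemma xy_linear_ext_is_monoid_morphism : monoid_morphism xy_linear_ext.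
Proof.
split; first by rewrite xy_linear_extU scale1r /xy_eval mul1r.
move=> a b; elim/monoid_algebra_ind: a => [|a1 a2 IH1 IH2|c s].
- by rewrite mul0r xy_linear_ext0 mul0r.
- by rewrite mulrDl 2!xy_linear_extD mulrDl -IH1 -IH2.
elim/monoid_algebra_ind: b => [|b1 b2 IH1 IH2|e t].
- by rewrite mulr0 xy_linear_ext0 mulr0.
- by rewrite mulrDr 2!xy_linear_extD mulrDr -IH1 -IH2.
rewrite monoid_algebraMUU [LHS]xy_linear_extU xy_evalM.
by rewrite -scalerA scalerAr scalerAl -2!xy_linear_extU.
Qed.

Lemma xy_linear_extx : xy_linear_ext << xy_x >> = u.
Proof. by rewrite xy_linear_extU scale1r /xy_eval expr1 mulr1. Qed.

Lemma xy_linear_exty : xy_linear_ext << xy_y >> = v.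
Proof. by rewrite xy_linear_extU scale1r /xy_eval expr0 mul1r expr1z. Qed.

End Representation.

Lemma xy_linear_ext_unique (F : fieldType) (A : unitAlgType F)
    (rho : {lrmorphism monoid_algebra F xy_semigroup -> A}) :
  rho =1 xy_linear_ext (rho << xy_x >>) (rho << xy_y >>).
Proof.
have rhoM s t : rho << (s * t)%g >> = rho << s >> * rho << t >>.
  by rewrite -rmorphM monoid_algebraMUU mulr1.
have rho1 : rho << 1%g >> = 1 by apply: rmorph1.
have rhoX s k : rho << (s ^+ k)%g >> = rho << s >> ^+ k.
  elim: k => [|k IH]; first by rewrite expg0 expr0 rho1.
  by rewrite expgS [LHS]rhoM exprS; congr (_ * _).
have yV : rho << xy_yV >> = (rho << xy_y >>)^-1.
  have yyV : rho << xy_y >> * rho << xy_yV >> = 1 by rewrite -rhoM xy_yyV.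
  have yVy : rho << xy_yV >> * rho << xy_y >> = 1 by rewrite -rhoM xy_yVy.
  have uy : rho << xy_y >> \is a GRing.unit.
    by apply/unitrP; exists (rho << xy_yV >>).
  by apply: (mulrI uy); rewrite yyV divrr.
have rhoXY m n : rho << XY m n >> = rho << xy_x >> ^+ m * rho << xy_y >> ^ n.
  rewrite XYE [LHS]rhoM; congr (_ * _); first exact: rhoX.
  case: n => n; first exact: rhoX.
  by rewrite [LHS]rhoX yV exprVn.
elim/monoid_algebra_ind => [|a b IHa IHb|c s].
- by rewrite raddf0 xy_linear_ext0.
- by rewrite raddfD /= xy_linear_extD IHa IHb.
rewrite xy_linear_extU -[c in LHS]mulr1 -monoid_algebraZU linearZ /=.
by congr (_ *: _); case: s => m n; apply: rhoXY.
Qed.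

Section Irreducible.

Variables (F : fieldType) (A : lalgType F) (n : nat).

(* Right representations act on row vectors by v |-> v *m rho a.               *)
Definition irreducible_repr (rho : {lrmorphism A -> 'M[F]_n}) : Prop :=
  (exists a, rho a != 0) /\
  forall W : {vspace 'rV[F]_n},
    (forall a v, v \in W -> v *m rho a \in W) -> W = 0%VS \/ W = fullv.

End Irreducible.

Section Pi.

Variable R : realType.
Local Notation C := R[i].

(* The period k is pi_d + 1, so that 'M_k is a non-zero ring; the indices      *)
(* 1, ..., k of the rows and columns are shifted to 0, ..., pi_d.              *)
Record pi_index := PiIndex {
  pi_alpha : C;
  pi_gamma : C;
  pi_d : nat;
  pi_alpha_neq0 : pi_alpha != 0;
  pi_alpha_period : pi_alpha ^+ (2 ^ pi_d.+1) = pi_alpha;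
  pi_minimal : forall j, (0 < j)%N ->
    pi_alpha ^+ (2 ^ j) = pi_alpha -> (pi_d.+1 <= j)%N;
  pi_gamma_neq0 : pi_gamma != 0
}.

Definition pi_X d : 'M[C]_d.+1 :=
  \matrix_(i, j) (((i == 0) && (j == ord_max)) || (i == j.+1 :> nat))%:R.

Definition pi_Y d (alpha : C) : 'M[C]_d.+1 :=
  diag_mx (\row_i alpha ^+ (2 ^ i)).

Definition pi_map (i : pi_index) :
    monoid_algebra C xy_semigroup -> 'M[C]_((pi_d i).+1) :=
  xy_linear_ext (pi_gamma i *: pi_X (pi_d i)) (pi_Y (pi_d i) (pi_alpha i)).

Lemma pi_Y_unit d (alpha : C) : alpha != 0 -> pi_Y d alpha \is a GRing.unit.
Proof.
move=> a0; rewrite -[_ \is a _]/(_ \in unitmx) unitmxE det_diag.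
rewrite unitfE prodf_seq_neq0; apply/allP => j _ /=.
by rewrite mxE expf_neq0.
Qed.

Lemma pi_YX (i : pi_index) (X := pi_gamma i *: pi_X (pi_d i))
  (Y := pi_Y (pi_d i) (pi_alpha i)) : Y * X = X * Y ^+ 2.
Proof.
rewrite /X /Y -scalerAr -scalerAl; congr (_ *: _).
apply/matrixP => r c; rewrite expr2 mulrA.
rewrite -[_ * _]/(_ *m _) -[(_ *m _) * _]/(_ *m _ *m _).
rewrite mul_diag_mx !mul_mx_diag !mxE -mulrA -exprD addnn -mul2n -expnS.
case: (altP (r =P 0)) => [->|rN0] /=.
  case: (altP (c =P ord_max)) => [->|cNm] /=.
    by rewrite expn0 expr1 mulr1 mul1r pi_alpha_period.
  by rewrite mulr0 mul0r.
by case: eqP => [->|_]; rewrite ?mulr0 ?mul0r // mulr1 mul1r.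
Qed.

HB.instance Definition _ (i : pi_index) :=
  GRing.isLinear.Build C (monoid_algebra C xy_semigroup) 'M[C]_((pi_d i).+1) *:%R
    (@pi_map i) (xy_linear_ext_is_linear _ _).

HB.instance Definition _ (i : pi_index) :=
  GRing.isMonoidMorphism.Build (monoid_algebra C xy_semigroup)
    'M[C]_((pi_d i).+1) (@pi_map i)
    (xy_linear_ext_is_monoid_morphism (pi_Y_unit _ (pi_alpha_neq0 i)) (pi_YX i)).

Definition pi_repr (i : pi_index) :
  {lrmorphism monoid_algebra C xy_semigroup -> 'M[C]_((pi_d i).+1)} := @pi_map i.

Lemma pi_repr_x i : pi_repr i << xy_x >> = pi_gamma i *: pi_X (pi_d i).
Proof. exact: xy_linear_extx. Qed.

Lemma pi_repr_y i : pi_repr i << xy_y >> = pi_Y (pi_d i) (pi_alpha i).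
Proof. exact: xy_linear_exty. Qed.

Lemma pi_repr_unique i
    (rho : {lrmorphism monoid_algebra C xy_semigroup -> 'M[C]_((pi_d i).+1)}) :
    rho << xy_x >> = pi_gamma i *: pi_X (pi_d i) ->
    rho << xy_y >> = pi_Y (pi_d i) (pi_alpha i) ->
  rho =1 pi_repr i.
Proof. by move=> rx ry a; rewrite xy_linear_ext_unique rx ry. Qed.

End Pi.

(* Main.v *)
Require Import Defs.
From mathcomp Require Import all_boot all_algebra.
From mathcomp Require Import reals complex.
From mathcomp Require Import cyclic separable cyclotomic finmap monalg zify.

(** Write k for the size of [pi_repr i]. Since 2 acts on the exponents of alpha
    with exact period k, the diagonal entries alpha, alpha^2, alpha^4, ... of Y
    are pairwise distinct ([pi_alpha_inj]). A subspace stable under Y is stable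
    under every polynomial in Y ([pi_Y_horner_mem]), so an invariant subspace
    containing some v with v_l <> 0 contains the basis vector e_l: apply the
    product of the Y - Y_jj for j <> l. The cyclic shift X then carries e_l to
    every other basis vector, and the subspace is the whole space.

    For separation, collect a non-zero element as a sum of x^m p_m(y) with
    Laurent polynomials p_m. The (r, c) entry of its image is the sum of the
    gamma^m p_m(alpha^(2^c)) over the m congruent to r - c modulo k
    ([pi_reprE]). Once k exceeds every m that occurs, the entry (m, 0) is just
    gamma^m p_m(alpha). It remains to find, for some p_m <> 0, an alpha of
    large period which is not a root of p_m ([avoid_roots]). A primitive
    (2^k - 1)-th root of unity has period exactly k ([doubling_period]), so
    different k give different values of alpha, whereas p_m has finitely many
    roots. The choice gamma = 1 suffices. *)

Set Implicit Arguments.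
Unset Strict Implicit.
Unset Printing Implicit Defensive.

Import GRing.Theory Num.Theory.
Local Open Scope ring_scope.

Lemma exists_prim_root (F : numClosedFieldType) n :
  (0 < n)%N -> exists z : F, n.-primitive_root z.
Proof.
move=> n_gt0; have [r Dr] := closed_field_poly_normal ('X^n - 1 : {poly F}).
move: Dr; rewrite (monicP _) ?monicXnsubC // scale1r => Dr.
have sz_r : (n <= size r)%N.
  by rewrite -ltnS -(size_prod_XsubC r id) -Dr size_XnsubC.
suff /(has_prim_root n_gt0) : all n.-unity_root r.
  have Ur : uniq r.
    rewrite -separable_prod_XsubC -Dr separable_Xn_sub_1 //.
    by rewrite pnatr_eq0 -lt0n.
  by case/(_ Ur sz_r)/hasP => z _; exists z.
by apply/allP=> z; rewrite -root_prod_XsubC -Dr.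
Qed.

(** A primitive root of unity of order 2^k - 1 is fixed by k squarings, and by
    no smaller positive number of them. *)
Lemma doubling_period (F : idomainType) (z : F) k : (0 < k)%N ->
    (2 ^ k - 1)%N.-primitive_root z ->
  [/\ z != 0, z ^+ (2 ^ k) = z
    & forall j, (0 < j)%N -> z ^+ (2 ^ j) = z -> (k <= j)%N].
Proof.
move=> k_gt0 prz.
have E j : z ^+ (2 ^ j) = z * z ^+ (2 ^ j - 1).
  by rewrite -exprS -subSn ?expn_gt0 // subn1.
have z0 : z != 0.
  apply/eqP => z0; have := prim_expr_order prz; rewrite z0 expr0n.
  by rewrite eqn0Ngt (prim_order_gt0 prz) => /eqP; rewrite eq_sym oner_eq0.
split=> // [|j j_gt0]; first by rewrite E (prim_expr_order prz) mulr1.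
rewrite E -[RHS]mulr1 => /(mulfI z0)/eqP; rewrite -(prim_order_dvd prz).
have j2 : (0 < 2 ^ j - 1)%N by rewrite subn_gt0 (ltn_exp2l 0).
move=> /(dvdn_leq j2).
by rewrite leq_sub2rE ?expn_gt0 // leq_exp2l.
Qed.

Section PiRepresentations.

Variable R : realType.
Local Notation C := R[i].

Lemma pi_XE d (i j : 'I_d.+1) :
  pi_X R d i j = (i == j.+1 %% d.+1 :> nat)%N%:R.
Proof.
rewrite mxE; congr (_ %:R); have [->|jm] := eqVneq j ord_max.
  rewrite modnn andbT -val_eqE /=.
  by rewrite (ltn_eqF (ltn_ord i)) orbF.
rewrite andbF /= modn_small // ltnS ltn_neqAle -ltnS ltn_ord andbT.
by move: jm; rewrite -val_eqE.
Qed.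

(** Acting on row vectors from the right, [X ^+ m] lowers the index of a basis
    vector by m modulo d + 1. *)
Lemma pi_X_expE d m (i j : 'I_d.+1) :
  (pi_X R d ^+ m) i j = (i == (j + m) %% d.+1 :> nat)%N%:R.
Proof.
elim: m j => [|m IH] j.
  by rewrite expr0 mxE addn0 modn_small.
rewrite exprSr mxE (bigD1 (inord (j.+1 %% d.+1))) //= pi_XE.
rewrite inordK ?ltn_mod // eqxx mulr1 IH inordK ?ltn_mod // modnDml addSnnS.
rewrite big1 ?addr0 // => l lj; rewrite pi_XE.
case: eqP => [lE|]; last by rewrite mulr0.
by case/eqP: lj; apply/val_inj; rewrite /= inordK ?ltn_mod.
Qed.

Lemma pi_Y_expE d (alpha : C) (z : int) : alpha != 0 ->
  pi_Y d alpha ^ z = diag_mx (\row_i (alpha ^+ (2 ^ i)) ^ z).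
Proof.
move=> a0.
have YX m : pi_Y d alpha ^+ m = diag_mx (\row_i (alpha ^+ (2 ^ i)) ^+ m).
  elim: m => [|m IH].
    by apply/matrixP => i j; rewrite expr0 !mxE expr0.
  rewrite exprSr IH -[LHS]/(_ *m _) mulmx_diag; congr diag_mx.
  by apply/rowP => i; rewrite !mxE exprSr.
case: z => m; first exact: YX.
(* For a negative exponent, both sides are inverse to [Y ^+ m.+1]. *)
apply: (mulrI (unitrX m.+1 (pi_Y_unit d a0))).
rewrite mulrV ?unitrX ?pi_Y_unit // YX -[RHS]/(_ *m _) mulmx_diag.
apply/matrixP => i j; rewrite !mxE /= mulfV //.
by rewrite !expf_neq0.
Qed.

Lemma pi_reprE (i : pi_index R) (a : monoid_algebra C xy_semigroup)
    (r c : 'I_(pi_d i).+1) :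
  pi_repr i a r c =
    \sum_(s <- msupp a | (r == (c + xdeg s) %% (pi_d i).+1 :> nat)%N)
      a@_s * (pi_gamma i ^+ xdeg s * (pi_alpha i ^+ (2 ^ c)) ^ ydeg s).
Proof.
rewrite [RHS]big_mkcond [LHS]summxE; apply: eq_bigr => s _.
rewrite mxE /xy_eval exprZn pi_Y_expE ?pi_alpha_neq0 // -scalerAl mxE.
rewrite -[_ * diag_mx _]/(_ *m _) mul_mx_diag !mxE pi_X_expE.
by case: ifP; rewrite ?mul0r ?mul1r ?mulr0.
Qed.

Lemma pi_alpha_inj (i : pi_index R) :
  injective (fun j : 'I_(pi_d i).+1 => pi_alpha i ^+ (2 ^ j)).
Proof.
suff H (j l : 'I_(pi_d i).+1) : (j < l)%N ->
    pi_alpha i ^+ (2 ^ j) <> pi_alpha i ^+ (2 ^ l).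
  move=> j l /= E; apply/val_inj => /=.
  by case: (ltngtP j l) => // /H; rewrite E.
move=> jl E.
(* Squaring E another k - j times turns the left side back into alpha. *)
have E' : pi_alpha i ^+ (2 ^ (l - j)) = pi_alpha i.
  rewrite -[in LHS](pi_alpha_period i) -exprM -expnD.
  have -> : ((pi_d i).+1 + (l - j) = l + ((pi_d i).+1 - j))%N.
    by have := ltn_ord j; lia.
  rewrite expnD exprM -E -exprM -expnD subnKC ?pi_alpha_period //.
  exact: ltnW.
have := pi_minimal _ E'; rewrite subn_gt0 => /(_ jl).
by have := ltn_ord l; lia.
Qed.

(** The row vector in the conclusion is v p(Y). *)
Lemma pi_Y_horner_mem d (alpha : C) (W : {vspace 'rV[C]_d.+1}) :
    (forall v, v \in W -> v *m pi_Y d alpha \in W) ->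
  forall (p : {poly C}) v, v \in W ->
    \row_j (v 0 j * p.[alpha ^+ (2 ^ j)]) \in W.
Proof.
move=> WY p v vW; elim/poly_ind: p => [|p c IH].
  rewrite [X in X \in W](_ : _ = 0) ?mem0v //.
  by apply/rowP => j; rewrite !mxE horner0 mulr0.
rewrite [X in X \in W](_ : _ =
  (\row_j (v 0 j * p.[alpha ^+ (2 ^ j)])) *m pi_Y d alpha + c *: v).
  by rewrite memvD ?memvZ // WY.
apply/rowP => j; rewrite mul_mx_diag !mxE hornerMXaddC mulrDr mulrA.
by rewrite [v 0 j * c]mulrC.
Qed.

Lemma pi_repr_irreducible (i : pi_index R) : irreducible_repr (pi_repr i).
Proof.
split; first by exists 1; rewrite rmorph1 oner_neq0.
set d := pi_d i => W Wstable.
have WY v : v \in W -> v *m pi_Y d (pi_alpha i) \in W.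
  by rewrite -pi_repr_y; apply: Wstable.
have WX v : v \in W -> v *m pi_X R d \in W.
  move=> /(Wstable << xy_x >>); rewrite pi_repr_x -scalemxAr.
  move=> /(memvZ (pi_gamma i)^-1); rewrite scalerA mulVf ?scale1r //.
  exact: pi_gamma_neq0.
have WXn m v : v \in W -> v *m (pi_X R d ^+ m) \in W.
  elim: m => [|m IH] vW; first by rewrite expr0 mulmx1.
  by rewrite exprSr -[_ * _]/(_ *m _) mulmxA WX ?IH.
have [->|W0] := eqVneq W 0%VS; [by left | right].
have vW := memv_pick W; have := vpick0 W; rewrite (negPf W0).
set v := vpick W in vW * => /negbT v0.
have [l vl] : exists l, v 0 l != 0.
  apply/existsP; apply: contraNT v0; rewrite negb_exists => /forallP v0.
  by apply/eqP/rowP => j; rewrite mxE; apply/eqP/negPn.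
pose beta (j : 'I_d.+1) := pi_alpha i ^+ (2 ^ j).
pose p := \prod_(j | j != l) ('X - (beta j)%:P).
have pE j : (p.[beta j] == 0) = (j != l).
  rewrite horner_prod; apply/idP/idP.
    case/prodf_eq0 => m ml; rewrite hornerXsubC subr_eq0 => /eqP.
    by move/pi_alpha_inj => ->.
  by move=> jl; rewrite (bigD1 j) //= hornerXsubC subrr mul0r.
(* v p(Y) is supported on the coordinate l alone. *)
have el : delta_mx 0 l \in W.
  have := memvZ (v 0 l * p.[beta l])^-1 (pi_Y_horner_mem WY p vW).
  congr (_ \in W); apply/rowP => j; rewrite !mxE eqxx /=.
  have [->|jl] := eqVneq j l.
    by rewrite mulVf // mulf_neq0 // pE eqxx.
  have := pE j; rewrite jl => /eqP pj.
  by rewrite -/(beta j) pj !mulr0.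
(* Lowering the index l by l + (d + 1 - j) gives j modulo d + 1. *)
have ej j : delta_mx 0 j \in W.
  have := WXn (l + (d.+1 - j))%N _ el; rewrite -rowE.
  congr (_ \in W); apply/rowP => m; rewrite !mxE eqxx pi_X_expE /=.
  congr (_ %:R).
  rewrite -[X in X == _](modn_small (ltn_ord l)) addnCA -{1}[l : nat]addn0.
  rewrite eqn_modDl mod0n -val_eqE /=.
  have := ltn_ord m; have := ltn_ord j.
  case: (ltngtP m j) => [mj jd _|jm jd md|-> jd _].
  - have lt: (m + (d.+1 - j) < d.+1)%N by lia.
    by rewrite modn_small //; lia.
  - have -> : (m + (d.+1 - j) = (m - j) + d.+1)%N by lia.
    by rewrite modnDr modn_small; lia.
  - by rewrite subnKC ?modnn // ltnW.
apply/vspaceP => w; rewrite memvf [w]row_sum_delta memv_suml // => j _.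
by rewrite memvZ.
Qed.

(** Parameters alpha of arbitrarily large period lie outside the zero set of a
    given non-zero polynomial. *)
Lemma avoid_roots (p : {poly C}) K : p != 0 ->
  exists i : pi_index R,
    [/\ pi_gamma i = 1, (K <= pi_d i)%N & ~~ root p (pi_alpha i)].
Proof.
move=> p0.
have prim k : exists z : C, (2 ^ k.+1 - 1)%N.-primitive_root z.
  by apply: exists_prim_root; rewrite subn_gt0 (ltn_exp2l 0).
pose z k := xchoose (prim k).
have zP k : (2 ^ k.+1 - 1)%N.-primitive_root (z k) := xchooseP (prim k).
have zE k := @doubling_period _ (z k) k.+1 isT (zP k).
have z0 k : z k != 0 by case: (zE k).
have z_per k : z k ^+ (2 ^ k.+1) = z k by case: (zE k).
have z_min k : forall j, (0 < j)%N -> z k ^+ (2 ^ j) = z k -> (k.+1 <= j)%N.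
  by case: (zE k).
(* The exact period k + 1 of [z k] determines k. *)
have z_inj : injective z.
  move=> k l E; apply/eqP; rewrite -eqSS eqn_leq.
  by rewrite z_min ?E ?z_per // z_min -?E ?z_per.
pose zs := [seq z (K + m)%N | m <- iota 0 (size p)].
have zs_uniq : uniq zs.
  by rewrite map_inj_uniq ?iota_uniq // => m n /z_inj/addnI.
have /hasP[_ /mapP[m _ ->] zm] : has (predC (root p)) zs.
  rewrite has_predC; apply/negP => roots.
  by have := max_poly_roots p0 roots zs_uniq; rewrite size_map size_iota ltnn.
exists (PiIndex (z0 _) (z_per _) (z_min (K + m)%N) (oner_neq0 C)).
by split; rewrite ?leq_addr.
Qed.

Lemma pi_repr_separates (a : monoid_algebra C xy_semigroup) :
  a != 0 -> exists i : pi_index R, pi_repr i a != 0.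
Proof.
move=> a0.
have [s0 s0a] : exists s0, s0 \in msupp a.
  apply/fset0Pn; apply: contraNneq a0 => a0.
  by rewrite [a]monalgE a0 big_seq_fset0.
(* N is large enough for y^N to clear every negative power of y in a. *)
pose N := (\sum_(s <- msupp a) absz (ydeg s))%N.
pose e s := absz (ydeg s + N%:Z).
have eE s : s \in msupp a -> (e s)%:Z = ydeg s + N%:Z.
  move=> sa; have : (absz (ydeg s) <= N)%N.
    by rewrite /N (big_fsetD1 s) //= leq_addr.
  by rewrite /e; lia.
(* p is y^N p_m(y), with m the exponent of x in s0. *)
pose p : {poly C} :=
  \sum_(s <- msupp a | xdeg s == xdeg s0) a@_s *: 'X^(e s).
have p0 : p != 0.
  apply/eqP => /(congr1 (fun q : {poly C} => q`_(e s0))) /eqP.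
  rewrite coef0 coef_sum big_mkcond (big_fsetD1 s0) //= eqxx coefZ coefXn.
  rewrite eqxx mulr1 big_seq big1 => [|s].
    by apply/negP; rewrite addr0 mcoeff_neq0.
  rewrite in_fsetD1 => /andP[ss sa]; case: eqP => // xs.
  rewrite coefZ coefXn; case: eqP => [es|]; last by rewrite mulr0.
  (* s and s0 agree in both exponents. *)
  case/eqP: ss; move: (eE _ sa) (eE _ s0a); rewrite -es => -> /addIr.
  by case: (s) (s0) xs => [m n] [m' n'] /= -> ->.
pose K := (\max_(s <- msupp a) xdeg s)%N.
have [i [g1 Ki /negP np]] := avoid_roots K p0.
have xs s : s \in msupp a -> (xdeg s < (pi_d i).+1)%N.
  move=> sa; rewrite ltnS (leq_trans _ Ki) //.
  by rewrite /K (big_fsetD1 s) //= leq_maxl.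
exists i; apply/eqP => /matrixP/(_ (inord (xdeg s0)) 0).
rewrite pi_reprE mxE => E; apply: np; apply/rootP.
(* The entry (m, 0), times alpha^N, is the value of p at alpha. *)
transitivity (0 * pi_alpha i ^+ N); last by rewrite mul0r.
rewrite -{}E horner_sum mulr_suml big_seq_cond [RHS]big_seq_cond.
apply: eq_big => [s|s /andP[sa _]].
  case: (boolP (s \in _)) => //= sa.
  by rewrite add0n inordK ?xs // modn_small ?xs // eq_sym.
rewrite hornerZ hornerXn g1 expr1n mul1r expn0 expr1 -mulrA; congr (_ * _).
by rewrite [LHS]exprnP eE // exprzDr ?unitfE ?pi_alpha_neq0.
Qed.

End PiRepresentations.

Theorem theorem3p2 (R : realType) :
  (forall i : pi_index R, irreducible_repr (pi_repr i)) /\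
  (forall a : monoid_algebra R[i] xy_semigroup,
     a != 0 -> exists i : pi_index R, pi_repr i a != 0).
Proof. by split; [apply: pi_repr_irreducible | apply: pi_repr_separates]. Qed.
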